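(* Let $\mathbb{X}$ be a finite dimensional real Hilbert space and let $f:\mathbb{X}\to\mathbb{R}\cup\{\infty\}$ be a proper closed function with $\inf f>-\infty$. Let $\phi:\mathbb{X}\to\mathbb{R}$ be a convex function that is twice continuously differentiable and for which there exists $a_1>0$ such that $\nabla^2\phi(x)-a_1\mathcal{I}\succeq0$ for all $x\in\mathbb{X}$. Suppose that $f$ is a KL function with exponent $\alpha\in[\frac12,1)$. Then the Bregman envelope $$F_\phi(x):=\inf_{y\in\mathbb{X}}\{f(y)+\mathfrak{B}_\phi(y,x)\},\qquad \mathfrak{B}_\phi(y,x):=\phi(y)-\phi(x)-\langle\nabla\phi(x),y-x\rangle,$$ is a KL function with exponent $\alpha$.
   Context: $\mathcal{I}$ is the identity map, and for a linear map $\mathcal{A}:\mathbb{X}\to\mathbb{X}$, $\mathcal{A}\succeq0$ means $\mathcal{A}$ is self-adjoint and $\langle h,\mathcal{A}h\rangle\ge0$ for all $h$. A function $h:\mathbb{X}\to\mathbb{R}\cup\{\infty\}$ is proper if $\operatorname{dom}h:=\{x:h(x)<\infty\}\neq\emptyset$, and closed if it is lower semicontinuous. The regular subdifferential of a proper $h$ at $x\in\operatorname{dom}h$ is $\hat\partial h(x)=\{\zeta:\liminf_{z\to x,z\ne x}\frac{h(z)-h(x)-\langle\zeta,z-x\rangle}{\|z-x\|}\ge0\}$; the (limiting) subdifferential is $\partial h(x)=\{\zeta:\exists\,x^k\to x,\ h(x^k)\to h(x),\ \zeta^k\to\zeta,\ \zeta^k\in\hat\partial h(x^k)\}$; both are empty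 for $x\notin\operatorname{dom}h$, and $\operatorname{dom}\partial h:=\{x:\partial h(x)\ne\emptyset\}$. Write $\operatorname{dist}(x,D):=\inf_{y\in D}\|x-y\|$ (with value $\infty$ if $D=\emptyset$). A proper closed $h$ satisfies the Kurdyka-Łojasiewicz (KL) property at $\hat x\in\operatorname{dom}\partial h$ with exponent $\alpha\in[0,1)$ if there exist $a\in(0,\infty]$, a neighborhood $V$ of $\hat x$ and $\bar c>0$ such that, with $\varphi(s)=\bar c s^{1-\alpha}$, $\varphi'(h(x)-h(\hat x))\operatorname{dist}(0,\partial h(x))\ge1$ for every $x\in V$ with $h(\hat x)<h(x)<h(\hat x)+a$. A proper closed $h$ is a KL function with exponent $\alpha$ if this holds (with the same $\alpha$) at every point of $\operatorname{dom}\partial h$. *)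

(* Defs.v *)
From HB Require Import structures.
From mathcomp Require Import all_boot all_order all_algebra.
From mathcomp Require Import all_classical all_reals all_analysis.

Set Implicit Arguments.
Unset Strict Implicit.
Unset Printing Implicit Defensive.

Import Order.TTheory GRing.Theory Num.Theory.
Import numFieldNormedType.Exports.

Local Open Scope classical_set_scope.
Local Open Scope ring_scope.

(* Completeness is automatic: [Vector] provides a linear isomorphism with some
   'rV[R]_n. *)
HB.mixin Record NormedModule_hasInner (R : realType) (X : Type)
    of NormedModule R X := {
  inner : {dot X for (@idfun R)} ;
  inner_norm : forall x : X, inner x x = `|x| ^+ 2
}.

#[short(type="finHilbertType")]
HB.structure Definition FinHilbert (R : realType) :=
  {X of NormedModule R X & Vector R X & NormedModule_hasInner R X}.

Section Smooth.
Context {R : realType} {X : finHilbertType R}.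
Implicit Types (phi : X -> R) (A : X -> X) (x y u v : X).

(* The Riesz representative of the Frechet derivative; junk when [phi] is not
   differentiable at [x]. *)
Definition gradient phi x : X :=
  get [set g : X | forall v, 'd phi x v = inner g v].

Definition hessian phi x : X -> X := 'd (gradient phi) x.

(* The last clause is continuity of the Hessian for the operator norm. *)
Definition twice_continuously_differentiable phi : Prop :=
  [/\ forall x, differentiable phi x,
      forall x, differentiable (gradient phi) x &
      forall x (e : R), 0 < e ->
        \forall y \near x, forall v,
          `|hessian phi y v - hessian phi x v| <= e * `|v| ].

Definition psd A : Prop :=
  (forall u v, inner (A u) v = inner u (A v)) /\ (forall v, 0 <= inner v (A v)).

Definition bregman phi y x : R := phi y - phi x - inner (gradient phi x) (y - x).

End Smooth.

Section Subdifferential.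
Context {R : realType} {X : finHilbertType R}.
Implicit Types (h : X -> \bar R) (x z : X) (D : set X).
Local Open Scope ereal_scope.

Definition dom h : set X := [set x | h x < +oo].

(* The first conjunct says that [h] takes values in R `|` {+oo}. *)
Definition proper_function h : Prop := (forall x, -oo < h x) /\ dom h !=set0.

Definition regular_subdiff h x : set X :=
  [set zeta | dom h x /\
    0 <= limf_einf
           (fun z => (h z - h x - (inner zeta (z - x)%R)%:E)
                     * (`|z - x|^-1)%R%:E) x^'].

Definition subdiff h x : set X :=
  [set zeta | dom h x /\
    exists xk zetak : nat -> X,
      [/\ xk @ \oo --> x, h \o xk @ \oo --> h x, zetak @ \oo --> zeta &
          forall k, regular_subdiff h (xk k) (zetak k)]].

Definition dom_subdiff h : set X := [set x | subdiff h x !=set0].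

Definition dist_set x D : \bar R := ereal_inf [set (`|x - y|%R)%:E | y in D].

Definition desingularizer (c alpha : R) : R -> R :=
  fun s => (c * s `^ (1 - alpha))%R.

Definition KL_at h (alpha : R) x0 : Prop :=
  exists (a : \bar R) (c : R),
    [/\ 0 < a, (0 < c)%R &
      \forall x \near x0, h x0 < h x -> h x < h x0 + a ->
        1 <= (derive1 (desingularizer c alpha) (fine (h x - h x0)))%:E
             * dist_set 0%R (subdiff h x)].

Definition KL_function h (alpha : R) : Prop :=
  [/\ (0 <= alpha < 1)%R, proper_function h, lower_semicontinuous h &
      forall x, dom_subdiff h x -> KL_at h alpha x].

Definition bregman_envelope h (phi : X -> R) x : \bar R :=
  ereal_inf [set h y + (bregman phi y x)%:E | y in [set: X]].

End Subdifferential.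

(* Main.v *)
(* A point [y] attaining the infimum in [F x = inf_y (f y + B(y, x))] satisfies
   [grad phi x - grad phi y \in subdiff f y], and every regular subgradient of
   [F] at [x] equals [hess phi x (x - y)], whose norm is at least [a1 |x - y|].
   So it suffices to bound [(F x - F x0)^alpha] by a multiple of [|x - y|] for
   [x] near [x0].  If [x0] does not minimize [f + B(., x0)], lower
   semicontinuity of [f] keeps [y] away from [x], and the bound is trivial.
   If it does, [F x - F x0 = (f y - f x0) + B(y, x)]: the KL inequality of [f]
   at [x0] controls the first term, as [grad phi] is locally Lipschitz, and the
   second one is [O(|x - y|^2)], whence the assumption [1/2 <= alpha].  The
   bound passes from regular to limiting subgradients by continuity. *)

Require Import Defs.
From HB Require Import structures.
From mathcomp Require Import all_boot all_order all_algebra.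
From mathcomp Require Import all_classical all_reals all_analysis.
From mathcomp Require Import lra ring.
Set Implicit Arguments.
Unset Strict Implicit.
Unset Printing Implicit Defensive.
Import Order.TTheory GRing.Theory Num.Theory.
Import numFieldNormedType.Exports.
Local Open Scope classical_set_scope.
Local Open Scope ring_scope.

Import VectorInternalTheory.

(* A sealed copy of [inner]: unification would otherwise keep unfolding it. *)
HB.lock Definition dotp {R : realType} {X : finHilbertType R} (u v : X) : R :=
  inner u v.
Canonical dotp_unlockable := Unlockable dotp.unlock.

(** * Inner product spaces: Cauchy-Schwarz, Riesz representation, compact balls *)

Section InnerProduct.
Context {R : realType} {X : finHilbertType R}.
Implicit Types (u v w : X) (a e : R).

Lemma innerE u v : dotp u v = inner u v.
Proof. by rewrite unlock. Qed.

Lemma dotpC u v : dotp u v = dotp v u.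
Proof. by rewrite unlock (hermC inner u v) /= expr0 mul1r. Qed.

Lemma dotpDl u v w : dotp (u + v) w = dotp u w + dotp v w.
Proof. by rewrite unlock; exact: linearDl. Qed.

Lemma dotpZl a u w : dotp (a *: u) w = a * dotp u w.
Proof. by rewrite unlock; exact: linearZl_LR. Qed.

Lemma dotpDr u v w : dotp w (u + v) = dotp w u + dotp w v.
Proof. by rewrite dotpC dotpDl !(dotpC w). Qed.

Lemma dotpZr a u w : dotp w (a *: u) = a * dotp w u.
Proof. by rewrite dotpC dotpZl !(dotpC w). Qed.

Lemma dotpNl u w : dotp (- u) w = - dotp u w.
Proof. by rewrite -scaleN1r dotpZl mulN1r. Qed.

Lemma dotpNr u w : dotp w (- u) = - dotp w u.
Proof. by rewrite dotpC dotpNl dotpC. Qed.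

Lemma dotpBl u v w : dotp (u - v) w = dotp u w - dotp v w.
Proof. by rewrite dotpDl dotpNl. Qed.

Lemma dotpBr u v w : dotp w (u - v) = dotp w u - dotp w v.
Proof. by rewrite dotpDr dotpNr. Qed.

Lemma dotp0r u : dotp u 0 = 0.
Proof. by rewrite -(scale0r u) dotpZr mul0r. Qed.

Lemma dotpxx u : dotp u u = `|u| ^+ 2.
Proof. by rewrite unlock; exact: inner_norm. Qed.

Lemma dotp_cauchy_schwarz u v : `|dotp u v| <= `|u| * `|v|.
Proof.
have [->|v0] := eqVneq v 0; first by rewrite dotp0r !normr0 mulr0.
have nv : 0 < `|v| ^+ 2 by rewrite exprn_gt0 // normr_gt0.
(* Expanding this square gives [|v|^2 (|u|^2 |v|^2 - (dotp u v)^2)], with no division by [|v|]. *)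
have : 0 <= dotp (`|v| ^+ 2 *: u - dotp u v *: v) (`|v| ^+ 2 *: u - dotp u v *: v).
  by rewrite dotpxx exprn_ge0.
rewrite !(dotpBl, dotpBr, dotpZl, dotpZr) !dotpxx (dotpC v u).
set s := dotp u v => h.
have {}h : s ^+ 2 <= `|u| ^+ 2 * `|v| ^+ 2.
  by rewrite -subr_ge0 -(pmulr_rge0 _ nv); move: h; congr (_ <= _); ring.
by rewrite -(ler_pXn2r (n := 2)) ?nnegrE ?mulr_ge0 // exprMn -normrX ger0_norm // sqr_ge0.
Qed.

Lemma dotp_le_norm u v : dotp u v <= `|u| * `|v|.
Proof. exact: le_trans (ler_norm _) (dotp_cauchy_schwarz u v). Qed.

Definition dotp_left (w : X) (u : X) : R := dotp u w.

Lemma dotp_left_linear w : linear (dotp_left w).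
Proof. by move=> a u v; rewrite /dotp_left dotpDl dotpZl. Qed.

HB.instance Definition _ w :=
  GRing.isLinear.Build R X R _ (dotp_left w) (dotp_left_linear w).

Lemma continuous_dotp_left w : continuous (dotp_left w).
Proof.
apply/linear_bounded_continuous/linear_boundedP; near=> M => u.
apply: le_trans (dotp_cauchy_schwarz _ _) _.
by rewrite mulrC ler_wpM2r //; near: M; exact: nbhs_pinfty_ge.
Unshelve. all: by end_near. Qed.

(** Sending [h] to its products with a basis is injective, since [h] orthogonal to the basis gives
    [dotp h h = 0]. Equality of dimensions makes it onto, so the products of [g] with the basis can
    be prescribed. *)
Lemma riesz_representation (l : {linear X -> R}) :
  exists g : X, forall v, l v = dotp g v.
Proof.
pose T (h : X) : 'rV[R]_(\dim {:X}) := \row_i dotp h (vbasis {:X})`_i.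
have Tlin : linear T.
  by move=> a u v; apply/rowP => i; rewrite !mxE dotpDl dotpZl.
pose TL : {linear X -> 'rV[R]_(\dim {:X})} :=
  HB.pack T (GRing.isLinear.Build R X 'rV[R]_(\dim {:X}) _ T Tlin).
have Tdot h v : T h = 0 -> dotp h v = 0.
  move=> Th0; rewrite (coord_vbasis (memvf v)).
  rewrite -[dotp h _]/(dotp h (\sum_i _)) dotpC -[dotp _ h]/(dotp_left h _).
  rewrite linear_sum big1 // => i _; rewrite linearZ /= /dotp_left dotpC.
  by move/rowP : Th0 => /(_ i); rewrite !mxE => ->; rewrite scaler0.
have kerT : lker (linfun TL) == 0%VS.
  apply/eqP/vspaceP => h; rewrite memv_ker lfunE /= memv0.
  apply/eqP/eqP => [Th0|->]; last exact: (linear0 TL).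
  by apply/eqP; rewrite -normr_eq0 -sqrf_eq0 -dotpxx Tdot.
have limT : limg (linfun TL) = fullv.
  apply/eqP; rewrite eqEdim subvf /= limg_dim_eq; last by rewrite (eqP kerT) capv0.
  by rewrite !dimvf /dim /= mul1n.
have : \row_i l (vbasis {:X})`_i \in limg (linfun TL) by rewrite limT memvf.
move=> /memv_imgP[g _]; rewrite lfunE /= => /rowP lg.
exists g => v; rewrite (coord_vbasis (memvf v)) linear_sum dotpC.
rewrite -[RHS]/(dotp_left g _) linear_sum; apply: eq_bigr => i _.
by rewrite !linearZ /= /dotp_left dotpC; have := lg i; rewrite !mxE => ->.
Qed.

(** The coordinate isomorphism [r2v] distorts norms by at most constant factors in both directions,
    so the ball is the continuous image of a closed bounded set of rows. *)
Lemma closed_ball_compact (x : X) (r : R) : compact [set y : X | `|y - x| <= r].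
Proof.
pose n := dim X.
have [r2vZ r2vD] := semilinearP (@r2v R X).
have r2v_lin : linear (@r2v R X) by move=> a u v; rewrite r2vD r2vZ.
pose r2vX : {linear 'rV[R]_n -> X} :=
  HB.pack (@r2v R X) (GRing.isLinear.Build R 'rV[R]_n X _ (@r2v R X) r2v_lin).
have r2v_le : exists2 K : R, 0 < K & forall u : 'rV[R]_n, `|r2vX u| <= K * `|u|.
  exists (1 + \sum_(i < n) `|r2vX (delta_mx 0 i)|).
    by rewrite ltr_pwDl // sumr_ge0.
  move=> u; rewrite {1}(row_sum_delta u) linear_sum.
  apply: le_trans (ler_norm_sum _ _ _) _; rewrite mulrDl mul1r -[leLHS]add0r.
  apply: lerD => //; rewrite mulr_suml; apply: ler_sum => i _.
  rewrite linearZ normrZ mulrC ler_wpM2l //.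
  rewrite [leRHS]/Num.Def.normr /= mx_normrE; apply/bigmax_geP; right => /=.
  by exists (ord0, i).
case: r2v_le => K K0 r2v_le.
have r2v_cont : continuous r2vX.
  apply/linear_bounded_continuous/linear_boundedP.
  apply: filterS (nbhs_pinfty_ge (num_real K)) => M KM u.
  by apply: le_trans (r2v_le u) _; rewrite ler_wpM2r.
have norm_cont : continuous (fun u : 'rV[R]_n => `|r2vX u|).
  by move=> u; exact: (cvg_norm (r2v_cont u)).
have [c c0 r2v_ge] : exists2 c : R, 0 < c & forall u : 'rV[R]_n, c * `|u| <= `|r2vX u|.
  have [S0|S0] := pselect ([set u : 'rV[R]_n | `|u| = 1] !=set0); last first.
    (* The unit sphere is empty only if every row is zero, and then any constant works. *)
    exists 1 => // u; have [->|u0] := eqVneq u 0; first by rewrite linear0 !normr0 mulr0.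
    exfalso; apply: S0; exists (`|u|^-1 *: u); rewrite /= normrZ normfV normr_id mulVf //.
    by rewrite normr_eq0.
  have Sc : compact [set u : 'rV[R]_n | `|u| = 1].
    apply: bounded_closed_compact.
      by exists 1; split => // M M1 u /= ->; exact: ltW.
    have := @preimage_closed _ _ (fun u : 'rV[R]_n => `|u|) [set t : R | t = 1].
    by apply; [move=> u _; exact: norm_continuous|exact: closed_eq].
  have [u0 u0S umin] := compact_EVT_min S0 Sc (continuous_subspaceT norm_cont).
  move: u0S; rewrite inE /= => u01.
  (* The minimum over the unit sphere is positive by injectivity; homogeneity extends the bound to
     all rows. *)
  exists (`|r2vX u0|).
    rewrite normr_gt0; apply/eqP => /(congr1 v2r); rewrite r2vK linear0 => u00.
    by move: u01; rewrite u00 normr0 => /esym/eqP; rewrite oner_eq0.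
  move=> u; have [->|un0] := eqVneq u 0; first by rewrite linear0 !normr0 mulr0.
  have nu : 0 < `|u| by rewrite normr_gt0.
  have : `|u|^-1 *: u \in [set u : 'rV[R]_n | `|u| = 1].
    by rewrite inE /= normrZ normfV normr_id mulVf // gt_eqF.
  move=> /umin; rewrite linearZ normrZ normfV normr_id => h.
  by rewrite -ler_pdivlMr // mulrC.
have -> : [set y : X | `|y - x| <= r] =
    r2vX @` [set u : 'rV[R]_n | `|r2vX u - x| <= r].
  apply/seteqP; split => y /=; last by case=> u ? <-.
  by move=> yr; exists (v2r y); rewrite v2rK.
apply: continuous_compact; first exact: continuous_subspaceT.
apply: bounded_closed_compact.
  exists ((r + `|x|) / c); split; first exact: num_real.
  move=> M rM u /= ur; apply: le_trans (ltW rM); rewrite ler_pdivlMr // mulrC.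
  apply: le_trans (r2v_ge u) _; rewrite -[X in `|X|](subrK x).
  by apply: le_trans (ler_normD _ _) _; rewrite lerD2r.
have := @preimage_closed _ _ (fun u : 'rV[R]_n => `|r2vX u - x|) [set t : R | t <= r].
apply; last exact: closed_le.
by move=> u _; exact: (cvg_norm (cvgB (r2v_cont u) (cvg_cst x))).
Qed.

End InnerProduct.

(** * Differentiability and the mean value theorem along a segment *)

Section Calculus.
Context {R : realType}.

Lemma differentiable_near {V W : normedModType R} (g : V -> W) (x : V) :
  differentiable g x -> forall e : R, 0 < e ->
  \forall z \near x, `|g z - g x - 'd g x (z - x)| <= e * `|z - x|.
Proof.
move=> /diff_locallyP[_ /eqaddoP dg] e e0.
have := dg e e0; rewrite !near_simpl => {}dg.
near=> z.
have -> : g z - g x - 'd g x (z - x) =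
    (g \o shift x - (cst (g x) + 'd g x)) (z - x).
  by rewrite /= !fctE /= /shift subrK opprD addrA.
near: z.
have : (z - x) @[z --> x] --> (0 : V).
  by rewrite -[X in _ --> X](subrr x); apply: cvgB; [exact: cvg_id|exact: cvg_cst].
exact: (fun h => h _ dg).
Unshelve. all: by end_near. Qed.

(** The one-dimensional mean value theorem for [t => g (x + t *: v)] on [[0, 1]]. *)
Lemma mean_value_segment {V : normedModType R} (g : V -> R) (x v : V) :
  (forall z, differentiable g z) ->
  exists2 c : R, 0 < c < 1 & g (x + v) - g x = 'd g (x + c *: v) v.
Proof.
move=> dg.
have der (t : R) : is_derive t 1 (fun t => g (x + t *: v)) ('d g (x + t *: v) v).
  have dgt := dg (x + t *: v).
  have E : (fun h : R => h^-1 *: (g (x + (h *: 1 + t) *: v) - g (x + t *: v))) =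
           (fun h : R => h^-1 *: (g (h *: v + (x + t *: v)) - g (x + t *: v))).
    by apply/funext => h; rewrite addrCA -scalerDl [h *: 1]mulr1.
  split.
    by rewrite /derivable /= E; exact: diff_derivable.
  by rewrite /derive /= E -(deriveE v dgt).
have [|c c01] := MVT (@ltr01 R) (fun t _ => der t).
  apply: derivable_within_continuous => t _.
  by have [] := der t.
rewrite subr0 mulr1 scale1r scale0r addr0 => ->.
by exists c.
Qed.

End Calculus.

(** * Gradients and mean value estimates for vector-valued maps *)

Section Gradient.
Context {R : realType} {X : finHilbertType R}.
Implicit Types (phi : X -> R) (x y u v w : X).

Lemma bregmanE phi x y :
  bregman phi y x = phi y - phi x - dotp (gradient phi x) (y - x).
Proof. by rewrite /bregman innerE. Qed.

Lemma diff_gradient phi x v :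
  differentiable phi x -> 'd phi x v = dotp (gradient phi x) v.
Proof.
move=> dphi.
have [g lg] := riesz_representation ('d phi x); rewrite unlock.
apply: (@getPex _ [set g | forall v, 'd phi x v = inner g v]); exists g => w.
by rewrite lg unlock.
Qed.

Lemma dotp_small_eq0 w x :
  (forall e : R, 0 < e -> \forall z \near x, dotp w (z - x) <= e * `|z - x|) ->
  w = 0.
Proof.
move=> small; apply/eqP; rewrite -normr_eq0; apply/negPn/negP => nw.
have w0 : 0 < `|w| by rewrite lt_def nw /=.
have /nbhs_normP[r /= r0 hr] := small _ (divr_gt0 w0 (ltr0n R 2)).
(* The test point [x + t *: w] lies at distance [r / 2] from [x], where the product is
   [|w| * (r / 2)], twice what the hypothesis allows for [e = |w| / 2]. *)
pose t := r / 2 / `|w|.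
have t0 : 0 < t by rewrite !divr_gt0.
have := hr (x + t *: w); rewrite /ball_ /= opprD addNKr normrN addrAC subrr add0r.
rewrite normrZ gtr0_norm // dotpZr dotpxx divfK // => /(_ _).
have -> : r / 2 < r by lra.
move=> /(_ isT); apply/negP; rewrite -ltNge.
have -> : r / 2 = t * `|w| by rewrite divfK.
rewrite expr2 mulrCA ltr_pM2l //; nra.
Qed.

(** A vector-valued map need not have one intermediate point for all directions, so [w] is fixed
    before [c] is found. *)
Lemma mean_value_dotp (G : X -> X) x v w : (forall z, differentiable G z) ->
  exists2 c : R, 0 < c < 1 &
    dotp (G (x + v) - G x) w = dotp ('d G (x + c *: v) v) w.
Proof.
move=> dG.
have dw z : differentiable (dotp_left w) z.
  exact/linear_differentiable/continuous_dotp_left.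
have [|c c01 E] := @mean_value_segment R X (dotp_left w \o G) x v.
  by move=> z; apply: differentiable_comp.
exists c => //; rewrite dotpBl [LHS]E diff_comp //= diff_lin //.
exact: continuous_dotp_left.
Qed.

(** Pairing the increment with itself turns the scalar mean value theorem into a norm bound. *)
Lemma mean_value_norm (G : X -> X) (x v : X) (L : R) :
  (forall z, differentiable G z) ->
  (forall c : R, 0 < c < 1 -> `|'d G (x + c *: v) v| <= L) ->
  `|G (x + v) - G x| <= L.
Proof.
move=> dG dGL; set w := G (x + v) - G x.
have [c c01] := mean_value_dotp x v w dG.
rewrite -/w dotpxx => E.
have [->|w0] := eqVneq w 0.
  by rewrite normr0; apply: le_trans (dGL c c01).
have nw : 0 < `|w| by rewrite normr_gt0.
rewrite -(ler_pM2r nw) -expr2 E; apply: le_trans (dotp_le_norm _ _) _.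
by rewrite ler_pM2r // dGL.
Qed.

End Gradient.

(** * Regular subgradients as first-order minorants *)

Section RegularSubdifferential.
Context {R : realType} {X : finHilbertType R}.
Implicit Types (h : X -> \bar R) (x z zeta : X).
Local Open Scope ereal_scope.

(** Removes the lower limit and the quotient: at [z = x] the inequality is trivial, so full
    neighbourhoods can replace punctured ones. *)
Lemma regular_subdiffP h x zeta : (forall z, -oo < h z) ->
  regular_subdiff h x zeta <-> dom h x /\ forall e : R, (0 < e)%R ->
    \forall z \near x, h x + (dotp zeta (z - x) - e * `|z - x|)%:E <= h z.
Proof.
move=> hNy; rewrite /regular_subdiff /=.
under eq_fun do rewrite -innerE.
suff H : dom h x -> (0 <= limf_einf (fun z =>
      (h z - h x - (dotp zeta (z - x)%R)%:E) * (`|z - x|^-1)%R%:E) x^' <->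
    forall e : R, (0 < e)%R ->
    \forall z \near x, h x + (dotp zeta (z - x) - e * `|z - x|)%:E <= h z).
  by split=> -[dx hx]; split => //; apply/(H dx).
rewrite /dom /= => hxy; move: (hNy x) hxy; case Ehx : (h x) => [a| |] // _ _.
(* For finite [h z] this is multiplication by [|z - x|]; for [h z = +oo] both sides hold. *)
have key z (e : R) : z != x ->
    ((- e)%:E <= (h z - a%:E - (dotp zeta (z - x)%R)%:E) * (`|z - x|^-1)%R%:E) =
    (a%:E + (dotp zeta (z - x) - e * `|z - x|)%:E <= h z).
  move=> zx; have nz : (0 < `|z - x|)%R by rewrite normr_gt0 subr_eq0.
  move: (hNy z); case: (h z) => [b| |] // _.
    by rewrite -!EFinB -EFinM !lee_fin ler_pdivlMr //; apply/idP/idP; lra.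
  by rewrite /= gt0_mulye ?lte_fin ?invr_gt0 // !leey.
rewrite limf_einfE; split.
  move=> h0 e e0.
  have : (- e)%:E < ereal_sup [set ereal_inf ((fun z =>
      (h z - a%:E - (dotp zeta (z - x)%R)%:E) * (`|z - x|^-1)%R%:E) @` V) | V in x^'].
    by apply: lt_le_trans h0; rewrite lte_fin oppr_lt0.
  move=> /ereal_sup_gt[_ [V Vx <-]] eV.
  have {}Vx : \forall z \near x, z != x -> V z := Vx.
  apply: filterS Vx => z Vz.
  have [->|zx] := eqVneq z x; first by rewrite Ehx subrr dotp0r normr0 mulr0 subrr adde0.
  rewrite -key //; apply: le_trans (ltW eV) _; apply: ereal_inf_lbound.
  by exists z => //; exact: Vz.
move=> he; apply/lee_addgt0Pr => e e0.
rewrite -leeBlDr // sub0e -EFinN.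
pose V := [set z | z != x /\
  a%:E + (dotp zeta (z - x) - e * `|z - x|)%:E <= h z].
apply: (@le_trans _ _ (ereal_inf ((fun z =>
      (h z - a%:E - (dotp zeta (z - x)%R)%:E) * (`|z - x|^-1)%R%:E) @` V))).
  by apply: le_ereal_inf_tmp => _ [z [zx zV] <-]; rewrite key.
apply: ereal_sup_ubound; exists V => //.
rewrite /dnbhs /within /=.
by apply: filterS (he e e0) => z hz zx; split.
Qed.

End RegularSubdifferential.

(** * The KL inequality on single subgradients, and its passage to limits *)

Section KLInequality.
Context {R : realType} {X : finHilbertType R}.

Lemma desingularizer_derive (c alpha s : R) : 0 < s ->
  derive1 (desingularizer c alpha) s = c * (1 - alpha) / s `^ alpha.
Proof.
move=> s0; have [d E] := is_derive1_powR (1 - alpha) s0.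
rewrite /desingularizer derive1Ml // derive1E E.
by rewrite [1 - alpha - 1]addrAC subrr add0r powRN mulrA.
Qed.

(** Quantifying over elements replaces the distance. An empty [D] is covered too: its distance is
    [+oo] and the right side is vacuous. *)
Lemma KL_inequalityP (c alpha s : R) (D : set X) : 0 < c -> alpha < 1 -> 0 < s ->
  (1 <= (derive1 (desingularizer c alpha) s)%:E * dist_set (0%R : X) D)%E <->
  forall z, D z -> s `^ alpha <= c * (1 - alpha) * `|z|.
Proof.
move=> c0 alpha1 s0; rewrite desingularizer_derive //.
have sa : 0 < s `^ alpha by rewrite powR_gt0.
set k := c * (1 - alpha) / s `^ alpha.
have k0 : 0 < k by rewrite divr_gt0 // mulr_gt0 // subr_gt0.
split=> [h z Dz|h].
  have dz : (dist_set (0%R : X) D <= `|z|%:E)%E.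
    by apply: ereal_inf_lbound; exists z => //; rewrite sub0r normrN.
  have := le_trans h (lee_wpmul2l (ltW k0 : (0 <= k%:E)%E) dz).
  by rewrite -EFinM lee_fin /k mulrAC ler_pdivlMr // mul1r.
have kd : ((k^-1)%:E <= dist_set (0%R : X) D)%E.
  apply: le_ereal_inf_tmp => _ [z Dz <-].
  rewrite lee_fin sub0r normrN /k invf_div ler_pdivrMr ?h //.
    by rewrite mulrC h.
  by rewrite mulr_gt0 // subr_gt0.
apply: le_trans (lee_wpmul2l (ltW k0 : (0 <= k%:E)%E) kd).
by rewrite -EFinM mulfV // gt_eqF.
Qed.

(** On [[0, 1]] a larger exponent gives a smaller power, so the worst case is the exponent 1/2,
    where the left side is [t]. *)
Lemma powR_quadratic_le (t alpha : R) : 0 <= t <= 1 -> 2^-1 <= alpha ->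
  (t ^+ 2) `^ alpha <= t.
Proof.
move=> /andP[t0 t1] ha; have [->|tn0] := eqVneq t 0.
  by rewrite expr0n powR0 // gt_eqF // (lt_le_trans _ ha) // invr_gt0.
have tp : 0 < t by rewrite lt_def tn0.
apply: (@le_trans _ _ ((t ^+ 2) `^ 2^-1)).
  by apply: ger_powR => //; rewrite exprn_gt0 // exprn_ile1.
by rewrite powR12_sqrt ?exprn_ge0 // sqrtr_sqr ger0_norm.
Qed.

Lemma regular_subdiff_sub (h : X -> \bar R) x zeta :
  regular_subdiff h x zeta -> subdiff h x zeta.
Proof.
move=> hz; split; first by case: hz.
by exists (fun=> x), (fun=> zeta); split=> //; exact: cvg_cst.
Qed.

(** The definition of [subdiff] includes convergence of the values [h (xk k)], so these eventually
    lie in the open set [A], and continuity of [q] carries the bound to the limit. *)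
Lemma subdiff_le (h : X -> \bar R) (x0 : X) (r : R) (A : set R) (q : R -> R) :
  (forall x, h x \is a fin_num) -> open A -> {in A, continuous q} ->
  (forall x zeta, `|x - x0| < r -> A (fine (h x)) -> regular_subdiff h x zeta ->
     q (fine (h x)) <= `|zeta|) ->
  forall x zeta, `|x - x0| < r -> A (fine (h x)) -> subdiff h x zeta ->
     q (fine (h x)) <= `|zeta|.
Proof.
move=> hfin Aopen qcont hreg x zeta xr Ax [_ [xk [zk [xkx hk zkz rk]]]].
have hk' : (fine \o (h \o xk)) @ \oo --> fine (h x).
  by apply: fine_cvg; rewrite fineK.
have qk : (q \o (fine \o (h \o xk))) @ \oo --> q (fine (h x)).
  by apply: (cvg_comp _ _ hk'); apply: qcont; rewrite inE.
apply: (ler_cvg_to qk (cvg_norm zkz)).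
near=> k; apply: hreg (rk k); near: k.
  by apply: (cvgr_lt _ (cvg_norm (cvgB xkx (cvg_cst x0)))).
by apply: hk'; exact: open_nbhs_nbhs (conj Aopen Ax).
Unshelve. all: by end_near. Qed.

End KLInequality.

(** * Gradient and Bregman distance of a strongly convex function *)

Section StronglyConvex.
Context {R : realType} {X : finHilbertType R}.
(* [G] and [H] are the gradient and the Hessian of [phi], kept abstract because
   comparing two terms [gradient phi _] by unfolding is prohibitively slow. *)
Context (phi : X -> R) (G : X -> X) (H : X -> X -> X) (a1 : R)
  (phi_differentiable : forall x, differentiable phi x)
  (diff_phi : forall x v, 'd phi x v = dotp (G x) v)
  (G_differentiable : forall x, differentiable G x)
  (diff_G : forall x v, 'd G x v = H x v)
  (H_continuous : forall x (e : R), 0 < e ->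
    \forall y \near x, forall v, `|H y v - H x v| <= e * `|v|)
  (H_sym : forall x u v, dotp (H x u) v = dotp u (H x v))
  (a1_gt0 : 0 < a1)
  (H_ge : forall x v, a1 * `|v| ^+ 2 <= dotp (H x v) v).
Implicit Types (x y v : X).

Definition breg y x := phi y - phi x - dotp (G x) (y - x).

Lemma phi_near x (e : R) : 0 < e ->
  \forall z \near x, `|phi z - phi x - dotp (G x) (z - x)| <= e * `|z - x|.
Proof.
move=> e0; apply: filterS (differentiable_near (phi_differentiable x) e0) => z.
by rewrite diff_phi.
Qed.

Lemma G_near x (e : R) : 0 < e ->
  \forall z \near x, `|G z - G x - H x (z - x)| <= e * `|z - x|.
Proof.
move=> e0; apply: filterS (differentiable_near (G_differentiable x) e0) => z.
by rewrite diff_G.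
Qed.

Lemma hessian_norm_ge x v : a1 * `|v| <= `|H x v|.
Proof.
have [->|v0] := eqVneq v 0; first by rewrite normr0 mulr0.
have nv : 0 < `|v| by rewrite normr_gt0.
rewrite -(ler_pM2r nv) -mulrA -expr2; apply: le_trans (H_ge x v) _.
exact: dotp_le_norm.
Qed.

Lemma gradient_strongly_monotone x v :
  a1 * `|v| ^+ 2 <= dotp (G (x + v) - G x) v.
Proof.
have [c _ ->] := mean_value_dotp x v v G_differentiable.
by rewrite diff_G.
Qed.

Lemma phi_mean_value x v : exists2 c : R, 0 < c < 1 &
  phi (x + v) - phi x = dotp (G (x + c *: v)) v.
Proof.
have [c c01 E] := mean_value_segment x v phi_differentiable.
by exists c => //; rewrite E diff_phi.
Qed.

(* Halving the segment turns the mean value theorem into a quadratic lower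
   bound, since the intermediate point of the second half is far from [x]. *)
Lemma phi_quadratic_growth x d :
  a1 / 4 * `|d| ^+ 2 <= phi (x + d) - phi x - dotp (G x) d.
Proof.
(* Strong monotonicity for the increment [t *: d], divided by [t]. *)
have mono (t : R) : 0 < t ->
    a1 * t * `|d| ^+ 2 <= dotp (G (x + t *: d)) d - dotp (G x) d.
  move=> t0; have := gradient_strongly_monotone x (t *: d).
  rewrite dotpZr normrZ (gtr0_norm t0) exprMn dotpBl => h.
  by rewrite -(ler_pM2l t0); move: h; congr (_ <= _); ring.
have [c1 /andP[c1_gt0 _]] := phi_mean_value x (2^-1 *: d).
have [c2 /andP[c2_gt0 _]] := phi_mean_value (x + 2^-1 *: d) (2^-1 *: d).
have -> : x + 2^-1 *: d + 2^-1 *: d = x + d.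
  by rewrite -addrA -scalerDl -[2^-1]mul1r -splitr scale1r.
have -> : x + 2^-1 *: d + c2 *: (2^-1 *: d) = x + (2^-1 + c2 * 2^-1) *: d.
  by rewrite scalerA scalerDl addrA.
have -> : x + c1 *: (2^-1 *: d) = x + (c1 * 2^-1) *: d by rewrite scalerA.
rewrite !dotpZr.
have := mono (c1 * 2^-1) ltac:(by rewrite mulr_gt0 // invr_gt0).
have := mono (2^-1 + c2 * 2^-1) ltac:(by rewrite addr_gt0 ?mulr_gt0 // invr_gt0).
have nd : 0 <= a1 * `|d| ^+ 2 by rewrite mulr_ge0 ?exprn_ge0 // ltW.
have := mulr_ge0 (ltW c1_gt0) nd; have := mulr_ge0 (ltW c2_gt0) nd.
move: (dotp (G x) d) (phi x) (phi (x + d)) (phi _) (`|d| ^+ 2).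
move: (dotp _ d) (dotp _ d).
by clear=> g1 g2 g3 p1 p2 p3 D; lra.
Qed.

Lemma breg_ge x y : a1 / 4 * `|y - x| ^+ 2 <= breg y x.
Proof. by have := phi_quadratic_growth x (y - x); rewrite subrKC. Qed.

Lemma breg_ge0 x y : 0 <= breg y x.
Proof.
by apply: le_trans (breg_ge x y); rewrite mulr_ge0 ?divr_ge0 ?exprn_ge0 // ltW.
Qed.

Lemma bregxx x : breg x x = 0.
Proof. by rewrite /breg !subrr dotp0r subrr. Qed.

(** Near [x0] the Hessian is within 1 of [H x0] in operator norm, hence the constant [k + 1]; the
    ball is convex, so the mean value bound applies on segments. *)
Lemma gradient_locally_lipschitz x0 : exists2 r : R, 0 < r &
  exists2 L : R, 0 < L & forall x y, `|x - x0| < r -> `|y - x0| < r ->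
    `|G y - G x| <= L * `|y - x|.
Proof.
have /linear_lipschitz[k k0 Hk] : continuous ('d G x0).
  exact: diff_continuous.
have /nbhs_normP[r /= r0 Hr] := H_continuous x0 ltr01.
exists r => //; exists (k + 1); first by rewrite addr_gt0.
move=> x y xr yr; rewrite -[y in G y](subrKC x).
apply: mean_value_norm => // c /andP[c0 c1].
have zr : `|x0 - (x + c *: (y - x))| < r.
  have -> : x0 - (x + c *: (y - x)) = (1 - c) *: (x0 - x) + c *: (x0 - y).
    rewrite scalerBl scale1r -addrA -scalerN -scalerDr opprB.
    by rewrite [x - x0 + _]addrA subrK opprD addrA -scalerN opprB.
  apply: le_lt_trans (ler_normD _ _) _; rewrite !normrZ !ger0_norm ?subr_ge0 ?ltW //.
  rewrite distrC [X in _ + _ * X]distrC.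
  have : (1 - c) * `|x - x0| < (1 - c) * r by rewrite ltr_pM2l // subr_gt0.
  have : c * `|y - x0| < c * r by rewrite ltr_pM2l.
  lra.
have := Hr _ zr (y - x); rewrite mul1r => h.
rewrite diff_G; move: h (Hk (y - x)); rewrite diff_G.
set u := H _ _; set v := H _ _ => uv vk.
rewrite -(subrK v u); apply: le_trans (ler_normD _ _) _.
by rewrite mulrDl mul1r addrC lerD.
Qed.

(** The right side equals [breg y x + breg x y], and the second term is nonnegative. *)
Lemma breg_le x y : breg y x <=
  dotp (G y - G x) (y - x).
Proof.
have := breg_ge0 y x; rewrite /breg dotpBl -(opprB y x) dotpNr; lra.
Qed.

(** Serves to compare the objectives at two centres [x] and [x0] for the same [y]. *)
Lemma breg_three_point x x0 y : breg y x0 =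
  breg y x + breg x x0 +
  dotp (G x - G x0) (y - x).
Proof.
by rewrite /breg !dotpBl !dotpBr; ring.
Qed.

Lemma breg_near_ge x y (e : R) : 0 < e ->
  \forall z \near y, breg y x - e <= breg z x.
Proof.
(* Moving [y] to [z] costs at most [|G y - G x| * |z - y|] to first order, plus [|z - y|] for the
   linearization error of [phi]. *)
move=> e0; set k := 1 + `|G y - G x|.
have k0 : 0 < k by rewrite ltr_pwDl.
near=> z.
have zy : `|z - y| <= e / k.
  by near: z; apply: cvgr_distC_le; [exact: cvg_id|exact: divr_gt0].
have : `|phi z - phi y - dotp (G y) (z - y)| <= 1 * `|z - y|.
  by near: z; exact: phi_near.
have := dotp_cauchy_schwarz (G y - G x) (z - y).
move: zy; rewrite ler_pdivlMr // /k mulrDr mulr1 mul1r !ler_norml.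
rewrite /breg !dotpBl !dotpBr mulrC => h1 /andP[h2 h3] /andP[h4 h5]; lra.
Unshelve. all: by end_near. Qed.

(** * The envelope, its proximal points and its subgradients *)

Section Envelope.
Context (f : X -> \bar R) (m : R)
  (f_proper : proper_function f)
  (f_closed : lower_semicontinuous f)
  (f_ge : forall y, (m%:E <= f y)%E).

Definition envelope (x : X) : \bar R :=
  ereal_inf [set (f y + (breg y x)%:E)%E | y in [set: X]].

(* [r] is the finite value of [f] at the proximal point [y] of [x]. *)
Definition prox x y (r : R) := f y = r%:E /\ envelope x = (r + breg y x)%:E.

Lemma envelope_le x y : (envelope x <= f y + (breg y x)%:E)%E.
Proof. by apply: ereal_inf_lbound; exists y. Qed.

(** Quadratic growth bounds [t ^+ 2], and [t <= t ^+ 2 + 1] avoids a square root. *)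
Lemma breg_bound x y (K : R) : breg y x <= K -> `|y - x| <= `|4 / a1 * K| + 1.
Proof.
move=> /(le_trans (breg_ge x y)); set t := `|y - x| => h.
have {}h : t ^+ 2 <= 4 / a1 * K.
  by rewrite mulrAC ler_pdivlMr // mulrC; move: h; rewrite mulrAC ler_pdivrMr //; lra.
have := ler_norm (4 / a1 * K).
have : 0 <= (t - 1) ^+ 2 by exact: sqr_ge0.
have : 0 <= t ^+ 2 by exact: sqr_ge0.
rewrite sqrrB1; nra.
Qed.

(** The direct method with filters: the near-minimizers [A e] eventually lie in a compact ball, and
    lower semicontinuity makes a cluster point optimal. *)
Lemma prox_exists x : exists y r, prox x y r.
Proof.
have [fNy [y0]] := f_proper; rewrite /dom /= => fy0.
have [r Fr] : exists r : R, envelope x = r%:E.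
  have Fy : (envelope x < +oo)%E.
    by apply: le_lt_trans (envelope_le x y0) _; rewrite lte_add_pinfty // ltry.
  have Fm : (m%:E <= envelope x)%E.
    apply: le_ereal_inf_tmp => _ [y _ <-].
    by rewrite -[m%:E]adde0 leeD // lee_fin breg_ge0.
  by move: Fy Fm; case: (envelope x) => [r| |] // _ _; exists r.
pose A (e : R) := [set y | (f y + (breg y x)%:E <= (r + e)%:E)%E].
have A_proper : ProperFilter (filter_from [set e : R | 0 < e] A).
  apply: filter_from_proper.
    apply: filter_from_filter; first by exists 1 => /=.
    move=> e1 e2 /= e10 e20; exists (Num.min e1 e2); first by rewrite lt_min e10.
    by move=> y Ay; split; apply: le_trans Ay _; rewrite lee_fin lerD2l ge_min lexx ?orbT.
  move=> e /= e0.
  have : (envelope x < (r + e)%:E)%E by rewrite Fr lte_fin ltrDl.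
  by move=> /ereal_inf_lt[_ [y _ <-] hy]; exists y; exact: ltW.
(* On [A 1] the bound [m <= f y] leaves at most [r + 1 - m] for the Bregman term. *)
have [] := @closed_ball_compact R X x (`|4 / a1 * (r + 1 - m)| + 1) _ A_proper.
  exists 1 => //= y Ay; apply: breg_bound.
  have := le_trans (leeD2r (breg y x)%:E (f_ge y)) Ay.
  by rewrite -EFinD lee_fin; lra.
move=> y [_ cly].
suff fy : (f y + (breg y x)%:E <= r%:E)%E.
  move: (f_ge y) fy; case Ey : (f y) => [s| |] // _; rewrite -EFinD lee_fin => sr.
  exists y, s; split => //; apply/eqP; rewrite eq_le.
  by have := envelope_le x y; rewrite Ey => ->; rewrite Fr lee_fin.
rewrite leNgt; apply/negP => ry.
have [a fa ra] : exists2 a : R, (a%:E < f y)%E & r < a + breg y x.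
  move: ry; case: (f y) (f_ge y) => [s _| |] //.
    rewrite -EFinD lte_fin => rs; exists ((s + r - breg y x) / 2).
      by rewrite lte_fin; lra.
    lra.
  by move=> _ _; exists (r - breg y x + 1); [exact: ltry|lra].
(* Near [y] the objective exceeds [a + breg y x - e = r + 2 e], while members of [A e] have value at
   most [r + e]. *)
pose e := (a + breg y x - r) / 3.
have e0 : 0 < e by rewrite divr_gt0 // subr_gt0.
have [V yV Va] := f_closed fa.
have yW := breg_near_ge x y e0.
have [z [Az [Vz Wz]]] := cly _ _ (ex_intro2 _ _ e e0 (fun=> id)) (filterI yV yW).
have : (a%:E + (breg z x)%:E <= (r + e)%:E)%E.
  by apply: le_trans Az; rewrite leeD2r // ltW // Va.
by rewrite -EFinD lee_fin; move: Wz; rewrite /e; lra.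
Qed.

Lemma envelope_fin x : exists v : R, envelope x = v%:E.
Proof. by have [y [r [_ ->]]] := prox_exists x; exists (r + breg y x). Qed.

Lemma envelope_proper : proper_function envelope.
Proof.
split=> [x|]; first by have [v ->] := envelope_fin x; rewrite ltNyr.
by exists 0; rewrite /dom /=; have [v ->] := envelope_fin 0; rewrite ltry.
Qed.

(** If [envelope x <= a] with [x] close to [x0], a proximal point [y] of [x] stays within [M] of
    [x]. Using [y] as a competitor at [x0] costs at most [k * |x - x0|] more, too little to reach
    [v0]. *)
Lemma envelope_closed : lower_semicontinuous envelope.
Proof.
move=> x0 a; have [v0 Ev0] := envelope_fin x0; rewrite Ev0 lte_fin => av0.
have [r r0 [L L0 lip]] := gradient_locally_lipschitz x0.
pose M := `|4 / a1 * (a - m)| + 1.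
have M0 : 0 < M by rewrite ltr_wpDl.
pose k := L * (r + M).
have k0 : 0 < k by rewrite mulr_gt0 // addr_gt0.
exists [set x | `|x - x0| < r /\ `|x - x0| < (v0 - a) / k].
  near=> x; split; near: x; apply: cvgr_distC_lt; try exact: cvg_id => //.
    exact: r0.
  by rewrite divr_gt0 // subr_gt0.
move=> x [xr xk]; rewrite ltNge; apply/negP => Fa.
have [y [s [fy Fx]]] := prox_exists x.
move: Fa; rewrite Fx lee_fin => sa.
have yM : `|y - x| <= M.
  by apply: breg_bound; have := f_ge y; rewrite fy lee_fin; lra.
have := envelope_le x0 y; rewrite Ev0 fy -EFinD lee_fin (breg_three_point x).
have Gx : `|G x - G x0| <= L * `|x - x0| by apply: lip; rewrite // subrr normr0.
have b1 : breg x x0 <= L * `|x - x0| * r.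
  apply: le_trans (breg_le x0 x) _; apply: le_trans (dotp_le_norm _ _) _.
  by apply: ler_pM => //; exact: ltW.
have b2 : dotp (G x - G x0) (y - x) <= L * `|x - x0| * M.
  by apply: le_trans (dotp_le_norm _ _) _; apply: ler_pM.
move: xk; rewrite ltr_pdivlMr // /k => xk h.
have : v0 <= a + (L * `|x - x0| * r + L * `|x - x0| * M) by lra.
lra.
Unshelve. all: by end_near. Qed.

(** Fermat's rule: [y] minimizes [f] plus a function that is differentiable at [y] with gradient
    [G y - G x]. *)
Lemma prox_regular_subdiff x y r : prox x y r -> regular_subdiff f y (G x - G y).
Proof.
move=> [fy Fx]; apply/regular_subdiffP; first by case: f_proper.
split; first by rewrite /dom /= fy ltry.
move=> e e0; apply: filterS (phi_near y e0) => z; rewrite fy ler_norml => /andP[_ hz].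
have := envelope_le x z; rewrite Fx; move: (f_ge z).
case: (f z) => [s| |] // _; last by move=> _; rewrite leey.
rewrite -!EFinD !lee_fin /breg; move: hz; rewrite !dotpBl !dotpBr; lra.
Qed.

(** The function [z => f y + breg y z] lies above the envelope and touches it at [x], so [zeta] must
    be its gradient there. *)
Lemma envelope_regular_subdiff x y r zeta : prox x y r ->
  regular_subdiff envelope x zeta -> zeta = H x (x - y).
Proof.
move=> [fy Fx] /regular_subdiffP[|_ hF]; first by case: envelope_proper.
apply/subr0_eq/(dotp_small_eq0 (x := x)) => e e0.
(* Four errors share [e]: the subgradient inequality, the expansion of [phi], the expansion of [G]
   paired with [y - x] (hence [e2]), and the term [dotp (G z - G x) (z - x)]. *)
pose e1 := e / 4; have e10 : 0 < e1 by rewrite divr_gt0.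
pose e2 := e1 / (`|y - x| + 1); have e20 : 0 < e2 by rewrite divr_gt0 // ltr_wpDl.
have G_cont : \forall z \near x, `|G z - G x| <= e1.
  by apply: cvgr_distC_le => //; exact: differentiable_continuous.
near=> z.
have Fz : (envelope x + (dotp zeta (z - x) - e1 * `|z - x|)%:E <= envelope z)%E.
  by near: z; exact: hF.
have {Fz}:= le_trans Fz (envelope_le z y); rewrite fy Fx -!EFinD lee_fin => Fz.
have : `|phi z - phi x - dotp (G x) (z - x)| <= e1 * `|z - x|.
  by near: z; exact: phi_near.
rewrite ler_norml => /andP[phz _].
have Gz : `|G z - G x - H x (z - x)| <= e2 * `|z - x| by near: z; exact: G_near.
have Gz1 : `|G z - G x| <= e1 by near: z; exact: G_cont.
have h1 : dotp (H x (z - x) - (G z - G x)) (y - x) <= e1 * `|z - x|.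
  apply: le_trans (dotp_le_norm _ _) _; rewrite distrC.
  apply: (@le_trans _ _ (e2 * `|z - x| * (`|y - x| + 1))).
    by apply: ler_pM => //; rewrite lerDl.
  by rewrite /e2 mulrAC divfK // gt_eqF // ltr_wpDl.
have h2 : dotp (G z - G x) (z - x) <= e1 * `|z - x|.
  by apply: le_trans (dotp_le_norm _ _) _; rewrite ler_wpM2r.
rewrite dotpBl (dotpC (H x _)) -H_sym.
move: Fz phz h1 h2; rewrite /breg.
rewrite -(opprB x y) !dotpNr; move: (H x (z - x)) => u.
rewrite /e1 !dotpBl !dotpBr; lra.
Unshelve. all: by end_near. Qed.

Lemma prox_growth (alpha v0 : R) x0 :
  2^-1 <= alpha < 1 -> KL_function f alpha -> envelope x0 = v0%:E ->
  exists r a C : R, [/\ 0 < r, 0 < a, 0 < C &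
    forall x y s, `|x - x0| < r -> prox x y s ->
      v0 < s + breg y x < v0 + a -> (s + breg y x - v0) `^ alpha <= C * `|x - y|].
Proof.
move=> /andP[alpha_ge alpha_lt1] [_ _ _ f_KL] Ev0.
have alpha0 : 0 <= alpha by apply: le_trans alpha_ge; rewrite invr_ge0.
(* When [v0 < f x0], treated first, [f > m'] near [x0] while [s < m'], so [y] is at least [r] away
   from [x0] and [r / 2] away from [x]. *)
have [fx0|fx0] := leP (f x0) v0%:E; last first.
  have [m' m'f vm'] : exists2 m' : R, (m'%:E < f x0)%E & v0 < m'.
    move: fx0; case: (f x0) (f_ge x0) => [t _| |] //.
      by rewrite lte_fin => vt; exists ((v0 + t) / 2); rewrite ?lte_fin; lra.
    by move=> _ _; exists (v0 + 1); [exact: ltry|lra].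
  have [V Vx0 Vf] := f_closed m'f.
  have /nbhs_normP[r /= r0 rV] := Vx0.
  have a0 : 0 < m' - v0 by rewrite subr_gt0.
  exists (r / 2), (m' - v0), ((m' - v0) `^ alpha / (r / 2)); split => //.
  - by rewrite divr_gt0.
  - by rewrite divr_gt0 ?powR_gt0 // divr_gt0.
  move=> x y s xr [fy _] /andP[h1 h2].
  have yr : r <= `|x0 - y|.
    rewrite leNgt; apply/negP => /rV /Vf; rewrite fy lte_fin.
    have := breg_ge0 x y; lra.
  have xy : r / 2 <= `|x - y|.
    have := ler_distD x x0 y; rewrite (distrC x0 x); lra.
  apply: (@le_trans _ _ ((m' - v0) `^ alpha)).
    by apply: ge0_ler_powR => //; rewrite ?nnegrE; lra.
  by rewrite mulrAC ler_pdivlMr ?divr_gt0 // ler_wpM2l // powR_ge0.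
have fx0E : f x0 = v0%:E.
  apply/eqP; rewrite eq_le fx0 -Ev0 /=.
  by have := envelope_le x0 x0; rewrite bregxx adde0.
(* Now [x0] is its own proximal point, so [G x0 - G x0] is a subgradient of [f] there and the KL
   property applies at [x0]. *)
have px0 : prox x0 x0 v0 by split; rewrite // bregxx addr0.
have [|a [c [a0 c0]]] := f_KL x0.
  by exists (G x0 - G x0); exact/regular_subdiff_sub/(prox_regular_subdiff px0).
move=> /nbhs_normP[r1 /= r10 hr1].
have [r2 r20 [L L0 lip]] := gradient_locally_lipschitz x0.
have [a' a'0 a'a] : exists2 a' : R, 0 < a' & (v0%:E + a'%:E <= v0%:E + a)%E.
  move: a0; case: (a) => [t| |] //; first by rewrite lte_fin => t0; exists t.
  by move=> _; exists 1; rewrite // addey // leey.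
(* If [|x - y| < r], then [y] is within [2 * r] of [x0], inside both the KL ball and the Lipschitz
   ball; the 1 serves [powR_quadratic_le]. *)
pose r := Num.min 1 (Num.min r1 r2) / 2.
have r0 : 0 < r by rewrite divr_gt0 // !lt_min ltr01 r10.
have r_le1 : 2 * r <= 1 by rewrite /r mulrC divfK // ge_min lexx.
have r_ler1 : 2 * r <= r1 by rewrite /r mulrC divfK // !ge_min lexx !orbT.
have r_ler2 : 2 * r <= r2 by rewrite /r mulrC divfK // !ge_min lexx !orbT.
pose C1 := a' `^ alpha / r.
(* [C1] serves when [y] is far from [x], [C2] when the Bregman term dominates [u], and [C3] when
   [s - v0] does. *)
pose C2 := (2 * L) `^ alpha.
pose C3 := 2 `^ alpha * (c * (1 - alpha) * L).
have C10 : 0 < C1 by rewrite divr_gt0 // powR_gt0.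
have C20 : 0 <= C2 by exact: powR_ge0.
have C30 : 0 <= C3.
  by rewrite mulr_ge0 ?powR_ge0 // !mulr_ge0 // ?subr_ge0 ltW.
exists r, a', (C1 + C2 + C3); split => //.
  by rewrite addrAC -addrA ltr_pwDl // addr_ge0.
move=> x y s xr pxy /andP[]; set u := s + breg y x - v0 => h1 h2.
have u0 : 0 < u by rewrite subr_gt0.
have ua : u < a' by rewrite /u; lra.
suff : [\/ u `^ alpha <= C1 * `|x - y|, u `^ alpha <= C2 * `|x - y| |
    u `^ alpha <= C3 * `|x - y|].
  have := mulr_ge0 (ltW C10) (normr_ge0 (x - y)).
  have := mulr_ge0 C20 (normr_ge0 (x - y)).
  have := mulr_ge0 C30 (normr_ge0 (x - y)).
  by rewrite !mulrDl => ? ? ? []; lra.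
have [xy|xy] := leP r `|x - y|.
  constructor 1; apply: (@le_trans _ _ (a' `^ alpha)).
    by apply: ge0_ler_powR; rewrite ?nnegrE // ltW.
  by rewrite /C1 mulrAC ler_pdivlMr // ler_wpM2l // powR_ge0.
have yx0 : `|y - x0| < 2 * r.
  have := ler_distD x y x0; rewrite (distrC y x); lra.
have Gxy : `|G x - G y| <= L * `|x - y| by apply: lip; lra.
have b_le : breg y x <= L * `|x - y| ^+ 2.
  apply: le_trans (breg_le x y) _; apply: le_trans (dotp_le_norm _ _) _.
  by rewrite distrC (distrC y) expr2 mulrA ler_wpM2r.
(* As [u] is the sum of [s - v0] and [breg y x], one of them is at least half of it. *)
have [ub|ub] := leP u (2 * breg y x).
  constructor 2; apply: (@le_trans _ _ ((2 * L * `|x - y| ^+ 2) `^ alpha)).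
    apply: ge0_ler_powR => //; rewrite ?nnegrE ?(ltW u0) //.
      by rewrite !mulr_ge0 // ?exprn_ge0 // ltW.
    by lra.
  have L20 : 0 <= 2 * L by rewrite mulr_ge0 // ltW.
  rewrite powRM ?exprn_ge0 // ler_wpM2l //; apply: powR_quadratic_le => //.
  by rewrite normr_ge0 /=; lra.
constructor 3.
have [fy _] := pxy.
have b0 := breg_ge0 x y.
have sv : 0 < s - v0 by rewrite /u in ub u0 *; lra.
have KLy : (s - v0) `^ alpha <= c * (1 - alpha) * `|G x - G y|.
  have : `|x0 - y| < r1 by rewrite distrC; lra.
  move=> /hr1; rewrite fy fx0E lte_fin => KLy.
  have vs : v0 < s by lra.
  have sa : (s%:E < v0%:E + a)%E.
    by apply: lt_le_trans a'a; rewrite -EFinD lte_fin; lra.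
  have := KLy vs sa; rewrite -EFinB /= => /(KL_inequalityP _ c0 alpha_lt1 sv).
  apply; exact/regular_subdiff_sub/(prox_regular_subdiff pxy).
apply: (@le_trans _ _ ((2 * (s - v0)) `^ alpha)).
  by apply: ge0_ler_powR => //; rewrite ?nnegrE; rewrite /u in ub u0 *; lra.
rewrite powRM ?(ltW sv) // /C3 -mulrA; apply: ler_wpM2l; first exact: powR_ge0.
apply: le_trans KLy _; rewrite -[leRHS]mulrA; apply: ler_wpM2l => //.
by rewrite mulr_ge0 ?ltW // subr_gt0.
Qed.

Lemma envelope_KL (alpha : R) :
  2^-1 <= alpha < 1 -> KL_function f alpha -> KL_function envelope alpha.
Proof.
move=> halpha f_KL; have /andP[alpha_ge alpha_lt1] := halpha.
split; last move=> x0 _.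
- by rewrite alpha_lt1 andbT; apply: le_trans alpha_ge; rewrite invr_ge0.
- exact: envelope_proper.
- exact: envelope_closed.
have [v0 Ev0] := envelope_fin x0.
have [r [a [C [r0 a0 C0 growth]]]] := prox_growth halpha f_KL Ev0.
(* The factor [1 - alpha] cancels the one from differentiating the desingularizer; [C] comes from
   the growth estimate and [a1] from [hessian_norm_ge]. *)
have c0 : 0 < C / a1 / (1 - alpha) by rewrite !divr_gt0 // subr_gt0.
exists a%:E, (C / a1 / (1 - alpha)); split; [by rewrite lte_fin|exact: c0|].
near=> x; have [v Ev] := envelope_fin x.
rewrite Ev Ev0 -EFinD !lte_fin => vv0 va.
rewrite -EFinB /=.
apply/KL_inequalityP => //; first by rewrite subr_gt0.
move=> zeta; rewrite divfK ?gt_eqF ?subr_gt0 //.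
rewrite -ler_pdivrMl ?divr_gt0 // invf_div => hz.
pose q t := a1 / C * (t - v0) `^ alpha.
(* Stated on a whole ball and an open range of values, since the limit argument needs the bound at
   the nearby points carrying regular subgradients. *)
suff key : forall x zeta, `|x - x0| < r ->
    `]v0, v0 + a[%classic (fine (envelope x)) -> subdiff envelope x zeta ->
    q (fine (envelope x)) <= `|zeta|.
  have := key x zeta; rewrite Ev /= in_itv /= vv0 va; exact.
apply: (@subdiff_le R X envelope x0 r `]v0, v0 + a[%classic q).
- by move=> z; have [w ->] := envelope_fin z.
- exact: interval_open.
- move=> t; rewrite inE /= in_itv /= => /andP[tv _].
  have tv0 : 0 < t - v0 by rewrite subr_gt0.
  apply: cvgM; first exact: cvg_cst.
  apply: (@continuous_comp _ _ _ (fun t => t - v0) (fun w => w `^ alpha)).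
    by apply: cvgB; [exact: cvg_id|exact: cvg_cst].
  have [dp _] := is_derive1_powR alpha tv0.
  exact/differentiable_continuous/derivable1_diffP.
- move=> z w zr zI /envelope_regular_subdiff.
  have [y [s pzy]] := prox_exists z.
  move=> /(_ _ _ pzy) ->; have [_ Ez] := pzy.
  move: zI; rewrite Ez /= in_itv /= => hv.
  have := growth z y s zr pzy hv; rewrite /q => h.
  apply: le_trans (hessian_norm_ge z (z - y)).
  by rewrite -mulrA ler_wpM2l ?(ltW a1_gt0) // mulrC ler_pdivrMr // mulrC.
Unshelve. all: by end_near. Qed.

End Envelope.
End StronglyConvex.

(** * Instantiation at the gradient and Hessian of [phi] *)

Theorem theorem5p2 (R : realType) (X : finHilbertType R)
    (f : X -> \bar R) (phi : X -> R) (a1 alpha : R)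
    (f_proper : proper_function f) (f_closed : lower_semicontinuous f)
    (f_bounded_below : (-oo < ereal_inf (range f))%E)
    (phi_convex : convex_function [set: convex_lmodType X] phi)
    (phi_C2 : twice_continuously_differentiable phi)
    (a1_gt0 : 0 < a1)
    (phi_hessian : forall x : X, psd (fun v : X => hessian phi x v - a1 *: v))
    (alpha_itv : 2^-1 <= alpha < 1)
    (f_KL : KL_function f alpha) :
  KL_function (bregman_envelope f phi) alpha.
Proof.
have [m f_ge] : exists m : R, forall y, (m%:E <= f y)%E.
  have f_inf y : (ereal_inf (range f) <= f y)%E by apply: ereal_inf_lbound; exists y.
  move: f_bounded_below f_inf; case: (ereal_inf (range f)) => [m _|_|] // f_inf.
    by exists m.
  (* An infimum equal to [+oo] forces every value of [f] to be [+oo], so any real bound will do. *)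
  by exists 0 => y; apply: le_trans (f_inf y); rewrite leey.
have [dphi dgrad Hcont] := phi_C2.
have Hsym x u v : dotp (hessian phi x u) v = dotp u (hessian phi x v).
  have [/(_ u v)] := phi_hessian x; rewrite -!innerE.
  by rewrite dotpBl dotpBr dotpZl dotpZr => + _; exact: addIr.
have Hge x v : a1 * `|v| ^+ 2 <= dotp (hessian phi x v) v.
  have [_ /(_ v)] := phi_hessian x; rewrite -innerE.
  by rewrite dotpBr dotpZr dotpxx subr_ge0 dotpC.
have -> : bregman_envelope f phi = envelope phi (gradient phi) f.
  apply/funext => x; rewrite /bregman_envelope /envelope.
  by under eq_fun do rewrite bregmanE.
exact: (envelope_KL dphi (fun x v => diff_gradient v (dphi x)) dgrad
  (fun _ _ => erefl) Hcont Hsym a1_gt0 Hge f_proper f_closed f_ge alpha_itv f_KL).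
Qed.
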